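(* For any $5$ pairwise distinct points in the plane $\mathbb{R}^2$ there are two intersecting segments, each joining two of these points, which have no common vertices (endpoints).
   Context: The segment joining $X$ and $Y$ is the closed segment; its vertices are $X$ and $Y$. Two segments intersect if they have at least one common point. The points are not assumed to be in general position. *)

(* Defs.v *)
From mathcomp Require Import all_boot all_order all_algebra.
From mathcomp Require Import boolp classical_sets set_interval reals.

Set Implicit Arguments.
Unset Strict Implicit.
Unset Printing Implicit Defensive.

Import Order.TTheory GRing.Theory Num.Theory.

Local Open Scope classical_set_scope.
Local Open Scope ring_scope.

Definition segment (R : realType) (X Y : 'rV[R]_2) : set 'rV[R]_2 :=
  [set (1 - t) *: X + t *: Y | t in `[0, 1]].

Definition vertices (R : realType) (X Y : 'rV[R]_2) : set 'rV[R]_2 :=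
  [set X; Y].

(* Main.v *)
Require Import Defs.
From mathcomp Require Import all_boot all_order all_algebra.
From mathcomp Require Import boolp classical_sets set_interval reals.
From mathcomp Require Import ring lra.

(** The idea is a parity argument on Radon partitions.  Four points A, B, C, D
    of the plane satisfy an affine dependency whose coefficients are, up to
    sign, the orientations (doubled signed areas) of the four triangles that
    they span.  When the product of these four orientations is nonnegative, the
    coefficients can be split two against two, each pair having coefficients
    of one weak sign ([even_split]).  Moving one pair to the other side of the
    dependency and dividing by the common weight exhibits a point lying on both
    segments ([segments_meet]).

    A triple of points lies in exactly two of the five 4-element subsets of a
    5-element set.  Hence the five products of orientations multiply to a
    square, and they cannot all be negative: some four of the points have a
    nonnegative product, and [four_points_meet] applies to them.

    The splitting needs a dependency with a nonzero coefficient, whereas the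
    one given by orientations vanishes identically on four collinear points.
    Whenever A, B, C are collinear, these three already carry a nontrivial
    dependency ([collinear_dependency]), and giving D the coefficient 0 makes
    the product of the coefficients zero, so that the same splitting works. *)

Import Order.TTheory GRing.Theory Num.Theory.

Local Open Scope classical_set_scope.
Local Open Scope ring_scope.

Definition orient {R : comPzRingType} (X Y Z : 'rV[R]_2) : R :=
  (Y 0 0 - X 0 0) * (Z 0 1 - X 0 1) - (Y 0 1 - X 0 1) * (Z 0 0 - X 0 0).

(** The product of the coefficients in [orient_dependency]: their two minus
    signs cancel. *)
Definition orient4 {R : comPzRingType} (X Y Z T : 'rV[R]_2) : R :=
  orient Y Z T * orient X Z T * orient X Y T * orient X Y Z.

Lemma row2P {R : Type} (X Y : 'rV[R]_2) :
  X 0 0 = Y 0 0 -> X 0 1 = Y 0 1 -> X = Y.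
Proof.
move=> e0 e1; apply/rowP => k.
have : (k == 0) || (k == 1) by case: k => [[|[|//]] ?].
by case/orP => /eqP ->.
Qed.

(** Cramer's rule: the weights are the cofactors of the 3 x 4 matrix whose
    columns are the homogeneous coordinates of the points. *)
Lemma orient_dependency {R : comPzRingType} (A B C D : 'rV[R]_2) :
  orient B C D *: A + (- orient A C D) *: B
    + orient A B D *: C + (- orient A B C) *: D = 0.
Proof. by apply: row2P; rewrite !mxE /orient; ring. Qed.

Lemma orient_sum {R : comPzRingType} (A B C D : 'rV[R]_2) :
  orient B C D - orient A C D + orient A B D - orient A B C = 0.
Proof. by rewrite /orient; ring. Qed.

(** The weights are the differences of one coordinate of the points; a
    coordinate that distinguishes [A] from [B] gives a nonzero last weight. *)
Lemma collinear_dependency {R : comPzRingType} (A B C : 'rV[R]_2) :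
  A <> B -> orient A B C = 0 ->
  exists a b c : R, [/\ c != 0, a + b + c = 0 & a *: A + b *: B + c *: C = 0].
Proof.
move=> AB; rewrite /orient => o0.
have [e0|n0] := eqVneq (B 0 0) (A 0 0); last first.
  exists (C 0 0 - B 0 0), (A 0 0 - C 0 0), (B 0 0 - A 0 0).
  split; [by rewrite subr_eq0|by ring|].
  by apply: row2P; rewrite !mxE; [ring|rewrite -o0; ring].
have [e1|n1] := eqVneq (B 0 1) (A 0 1).
  by case: AB; apply: row2P; [rewrite e0|rewrite e1].
exists (C 0 1 - B 0 1), (A 0 1 - C 0 1), (B 0 1 - A 0 1).
split; [by rewrite subr_eq0|by ring|].
by apply: row2P; rewrite !mxE; [rewrite -[RHS]oppr0 -o0; ring|ring].
Qed.

Lemma same_sign_sum_eq0 {R : realDomainType} (a b : R) :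
  0 <= a * b -> a + b = 0 -> a = 0 /\ b = 0.
Proof.
move=> ab /eqP; rewrite addr_eq0 => /eqP ea; subst a.
move: ab; rewrite mulNr oppr_ge0 -expr2 => h.
have /eqP : b ^+ 2 == 0 by rewrite eq_le h sqr_ge0.
by move/eqP; rewrite sqrf_eq0 => /eqP ->; rewrite oppr0.
Qed.

Lemma weighted_in_segment {R : realType} (A B : 'rV[R]_2) (a b : R) :
  0 <= a * b -> a + b != 0 ->
  segment A B ((a + b)^-1 *: (a *: A + b *: B)).
Proof.
move=> ab s0; exists (b / (a + b)).
  (* b / (a + b) = b (a + b) / (a + b) ^ 2, and likewise for a / (a + b). *)
  have s2 : 0 < (a + b) ^+ 2 by rewrite exprn_even_gt0.
  have eb : b / (a + b) = (a * b + b ^+ 2) / (a + b) ^+ 2 by field.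
  have ea : 1 - b / (a + b) = (a * b + a ^+ 2) / (a + b) ^+ 2 by field.
  rewrite /= in_itv /=; apply/andP; split.
    by rewrite eb divr_ge0 ?addr_ge0 ?sqr_ge0 // ltW.
  by rewrite -subr_ge0 ea divr_ge0 ?addr_ge0 ?sqr_ge0 // ltW.
rewrite scalerDr !scalerA; congr (_ *: _ + _ *: _); by field.
Qed.

(** Both weighted means of the dependency are the same point: the two pairs
    have opposite weights and opposite weighted sums. *)
Lemma segments_meet {R : realType} (A B C D : 'rV[R]_2) (a b c d : R) :
  a *: A + b *: B + c *: C + d *: D = 0 -> a + b + c + d = 0 ->
  ~ [/\ a = 0, b = 0, c = 0 & d = 0] ->
  0 <= a * b -> 0 <= c * d ->
  segment A B `&` segment C D !=set0.
Proof.
move=> dep sum0 nz ab cd.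
have ecd : c + d = - (a + b).
  by apply/eqP; rewrite -addr_eq0 -sum0; apply/eqP; ring.
have s0 : a + b != 0.
  apply/eqP => s0; apply: nz.
  have [-> ->] := same_sign_sum_eq0 _ _ ab s0.
  have cd0 : c + d = 0 by rewrite ecd s0 oppr0.
  by have [-> ->] := same_sign_sum_eq0 _ _ cd cd0.
exists ((a + b)^-1 *: (a *: A + b *: B)); split.
  exact: weighted_in_segment.
have -> : (a + b)^-1 *: (a *: A + b *: B) = (c + d)^-1 *: (c *: C + d *: D).
  rewrite ecd invrN scaleNr -scalerN; congr (_ *: _).
  by apply/eqP; rewrite -addr_eq0 addrA dep.
by apply: weighted_in_segment; rewrite // ecd oppr_eq0.
Qed.

Lemma mul_neg_neg {R : realDomainType} (x y z : R) :
  x * y < 0 -> x * z < 0 -> 0 < y * z.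
Proof.
move=> xy xz.
have x0 : x != 0 by apply: contraTneq xy => ->; rewrite mul0r ltxx.
have : 0 < (x * y) * (x * z) by rewrite nmulr_rgt0.
by rewrite mulrACA -expr2 pmulr_rgt0 // exprn_even_gt0.
Qed.

(** With no zero among the numbers, evenly many are negative, and equal signs
    can be paired.  If one of them is zero, two of the other three agree in
    weak sign, and the zero goes with the remaining one. *)
Lemma even_split {R : realDomainType} (a b c d : R) : 0 <= a * b * c * d ->
  [\/ 0 <= a * b /\ 0 <= c * d, 0 <= a * c /\ 0 <= b * d
    | 0 <= a * d /\ 0 <= b * c].
Proof.
move=> prod_ge0.
have [/andP[]|] := boolP ((0 <= a * b) && (0 <= c * d)); first by constructor.
rewrite negb_and -!ltNge => n1.
have [/andP[]|] := boolP ((0 <= a * c) && (0 <= b * d)); first by constructor.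
rewrite negb_and -!ltNge => n2.
have [/andP[]|] := boolP ((0 <= a * d) && (0 <= b * c)); first by constructor.
rewrite negb_and -!ltNge => n3; exfalso.
(* Two negative products from different splittings share a factor, so the
   product of the other two factors is positive; the latter product and its
   complement are the third splitting, where one of them is negative. *)
case/orP: n1 => n1; case/orP: n2 => n2.
- have bc := mul_neg_neg _ _ _ n1 n2.
  case/orP: n3 => n3; nra.
- rewrite mulrC in n1; have ad := mul_neg_neg _ _ _ n1 n2.
  case/orP: n3 => n3; nra.
- rewrite (mulrC a c) in n2; have ad := mul_neg_neg _ _ _ n1 n2.
  case/orP: n3 => n3; nra.
- rewrite mulrC in n1; rewrite mulrC in n2; have bc := mul_neg_neg _ _ _ n1 n2.
  case/orP: n3 => n3; nra.
Qed.

Lemma dependency_meet {R : realType} (A B C D : 'rV[R]_2) (a b c d : R) :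
  a *: A + b *: B + c *: C + d *: D = 0 -> a + b + c + d = 0 ->
  ~ [/\ a = 0, b = 0, c = 0 & d = 0] -> 0 <= a * b * c * d ->
  [\/ segment A B `&` segment C D !=set0,
      segment A C `&` segment B D !=set0
    | segment A D `&` segment B C !=set0].
Proof.
move=> dep sum0 nz /even_split[] [h1 h2].
- by apply: Or31; apply: (segments_meet _ _ _ _ a b c d).
- apply: Or32; apply: (segments_meet _ _ _ _ a c b d) => //;
    last by case=> *; apply: nz.
    by rewrite (addrAC (a *: A)).
  by rewrite (addrAC a).
- apply: Or33; apply: (segments_meet _ _ _ _ a d b c) => //;
    last by case=> *; apply: nz.
    by rewrite (addrAC (a *: A)) (addrAC _ (d *: D) (c *: C)).
  by rewrite (addrAC a) (addrAC _ d c).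
Qed.

Lemma four_points_meet {R : realType} (A B C D : 'rV[R]_2) : A <> B ->
  0 <= orient4 A B C D ->
  [\/ segment A B `&` segment C D !=set0,
      segment A C `&` segment B D !=set0
    | segment A D `&` segment B C !=set0].
Proof.
move=> AB prod_ge0.
have [o0|o_neq0] := eqVneq (orient A B C) 0.
  have [a [b [c [c0 sum0 dep]]]] := collinear_dependency _ _ _ AB o0.
  apply: (dependency_meet _ _ _ _ a b c 0).
  - by rewrite scale0r addr0.
  - by rewrite addr0.
  - by case=> _ _ /eqP; rewrite (negbTE c0).
  - by rewrite mulr0.
apply: (dependency_meet _ _ _ _ _ _ _ _ (orient_dependency A B C D)).
- exact: orient_sum.
- by case=> _ _ _ /eqP; rewrite oppr_eq0 (negbTE o_neq0).
- by rewrite mulrN mulrN !mulNr opprK.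
Qed.

Lemma vertices_disjoint {R : realType} (X Y Z T : 'rV[R]_2) :
  X <> Z -> X <> T -> Y <> Z -> Y <> T ->
  vertices X Y `&` vertices Z T = set0.
Proof.
by move=> ? ? ? ?; rewrite -subset0 /vertices => Q [] [] -> [].
Qed.

(** Each triple of the five points is contained in exactly two of the five
    quadruples, so the product of the five numbers is a square; five is odd,
    so five negative numbers would have a negative product. *)
Lemma some_orient4_ge0 {R : realDomainType} (A B C D E : 'rV[R]_2) :
  [|| 0 <= orient4 A B C D, 0 <= orient4 A B C E, 0 <= orient4 A B D E,
      0 <= orient4 A C D E | 0 <= orient4 B C D E].
Proof.
have [//|n1] := leP 0 (orient4 A B C D).
have [//|n2] := leP 0 (orient4 A B C E).
have [//|n3] := leP 0 (orient4 A B D E).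
have [//|n4] := leP 0 (orient4 A C D E).
have [//|n5] := leP 0 (orient4 B C D E).
suff : orient4 A B C D * orient4 A B C E * orient4 A B D E * orient4 A C D E
         * orient4 B C D E >= 0.
  by rewrite leNgt pmulr_rlt0 ?n5 // nmulr_lgt0 // pmulr_rlt0 // nmulr_rgt0.
have -> : orient4 A B C D * orient4 A B C E * orient4 A B D E * orient4 A C D E
            * orient4 B C D E
  = (orient A B C * orient A B D * orient A B E * orient A C D * orient A C E
     * orient A D E * orient B C D * orient B C E * orient B D E
     * orient C D E) ^+ 2.
  by rewrite /orient4; ring.
exact: sqr_ge0.
Qed.

Theorem proposition1p1 (R : realType) (P : 'I_5 -> 'rV[R]_2)
    (P_inj : injective P) :
  exists i j k l : 'I_5,
    [/\ i != j, k != l,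
        vertices (P i) (P j) `&` vertices (P k) (P l) = set0 &
        segment (P i) (P j) `&` segment (P k) (P l) !=set0].
Proof.
have P_neq i j : i != j -> P i <> P j.
  by move=> /eqP ij /P_inj.
have four i j k l : uniq [:: i; j; k; l] ->
    0 <= orient4 (P i) (P j) (P k) (P l) ->
    exists i j k l : 'I_5,
    [/\ i != j, k != l,
        vertices (P i) (P j) `&` vertices (P k) (P l) = set0 &
        segment (P i) (P j) `&` segment (P k) (P l) !=set0].
  rewrite /= !inE !negb_or => /andP[/and3P[ij ik il] /andP[/andP[jk jl]]].
  rewrite andbT => kl /(four_points_meet _ _ _ _ (P_neq _ _ ij)).
  case=> meet; [exists i, j, k, l|exists i, k, j, l|exists i, l, j, k];
    by split=> //; apply: vertices_disjoint; apply: P_neq; rewrite // eq_sym.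
pose o n (lt_n5 : (n < 5)%N) : 'I_5 := Ordinal lt_n5.
have /or4P[| | |/orP[|]] := some_orient4_ge0
  (P (o 0 isT)) (P (o 1 isT)) (P (o 2 isT)) (P (o 3 isT)) (P (o 4 isT));
  exact: four.
Qed.
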